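(* There is an absolute constant $C>0$ such that for every integer $d\ge 1$, the class of all graphs of sd-degeneracy at most $d$ admits an adjacency labeling scheme with labels of at most $C\sqrt{dn}\,\log^3 n$ bits on $n$-vertex graphs (for all $n\ge 2$); i.e., labels have length $O(\sqrt{dn}\log^3 n)$.
   Context: For a graph $G$ and distinct vertices $u,v$, let $\mathrm{sd}_G(u,v) := |(N_G(u)\setminus\{v\}) \triangle (N_G(v)\setminus\{u\})|$ ($N_G$ = open neighborhood). The sd-degeneracy $\mathrm{sdd}(G)$ is the smallest non-negative integer $d$ such that either $|V(G)|=1$, or there exist distinct $u,v\in V(G)$ with $\mathrm{sd}_G(u,v)\le d$ and $\mathrm{sdd}(G-v)\le d$. A class $\mathcal C$ of graphs admits an $f(n)$-bit adjacency labeling scheme if there is a function (decoder) $D$ from pairs of binary strings to $\{0,1\}$ such that for every $n$-vertex graph $G\in\mathcal C$ one can assign to each vertex $v$ a binary string $\ell(v)$ of length at most $f(n)$ so that for all distinct $u,v\in V(G)$, $D(\ell(u),\ell(v))=1$ iff $uv\in E(G)$. Logarithms are base 2. *)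

(* Defs.v *)
From mathcomp Require Import all_boot.
From Stdlib Require Import Reals.

Set Implicit Arguments.
Unset Strict Implicit.
Unset Printing Implicit Defensive.

(* A simple graph is a symmetric irreflexive relation e on a finite type T;
   we work with induced subgraphs on vertex sets V : {set T}. *)

(* sd_{G[V]}(u,v) = |(N(u)\{v}) Δ (N(v)\{u})|, neighbourhoods taken in G[V].
   (For irreflexive e, w = u and w = v never belong to the symmetric difference.) *)
Definition sd (T : finType) (e : rel T) (V : {set T}) (u v : T) : nat :=
  #|[set w in V | [&& w != u, w != v & e u w != e v w]]|.

(* sdd(G[V]) = 0 if |V| = 1, otherwise the smallest d such that there are
   distinct u,v in V with sd(u,v) <= d and sdd(G[V] - v) <= d, i.e.
   min over ordered pairs (u,v) of distinct vertices of max(sd(u,v), sdd(G[V]-v)).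
   The recursion is on the fuel k = |V|. The neutral element #|T| of the
   minimum is never attained spuriously since all values are <= #|T|. *)
Fixpoint sdd_fuel (T : finType) (e : rel T) (k : nat) (V : {set T}) : nat :=
  match k with
  | 0 => 0
  | k'.+1 =>
      if #|V| <= 1 then 0
      else \big[minn/#|T|]_(u in V) \big[minn/#|T|]_(v in V | v != u)
              maxn (sd e V u v) (sdd_fuel e k' (V :\ v))
  end.

Definition sdd (T : finType) (e : rel T) (V : {set T}) : nat :=
  sdd_fuel e #|V| V.

Definition sdd_graph (n : nat) (e : rel 'I_n) : nat := sdd e [set: 'I_n].

Definition log2 (x : R) : R := (ln x / ln 2)%R.

(* Main.v *)
(* Undo the elimination order: each deleted vertex v is put back, in a linear order
   of the vertices, directly behind its twin u.  With every old interval containing u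
   stretched to contain v too, v inherits all adjacencies of u, and the at most d + 1
   pairs involving v that must differ are corrected by 1 x 1 rectangles of higher
   priority.  Thus the adjacency matrix is given by at most 2(d + 1)n prioritised
   rectangles, the entry at (x, y) being read off the top rectangle containing it.

   Cut the positions into O(sqrt (dn)) blocks, each split by at most O(sqrt (dn))
   rectangles.  A rectangle splitting neither of two blocks contains their product or
   misses it.  So a vertex only stores the rectangles that split its own block and, for
   every block, the priority of the top rectangle that splits neither that block nor its
   own and contains their product.  These are O(sqrt (dn)) numbers of O(log n) bits, so
   one logarithm already suffices. *)
Require Import Defs.
From mathcomp Require Import zify.
From Stdlib Require Import Reals Lra.
From mathcomp Require Import all_boot.

(* [zify] loads MathComp's algebra, which rebinds [%R] to its own [ring_scope]. *)
Delimit Scope R_scope with R.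

Set Implicit Arguments.
Unset Strict Implicit.
Unset Printing Implicit Defensive.

(** * Twin vertices from a bound on sd-degeneracy *)

Lemma bigminn_attained (I : finType) (P : pred I) (F : I -> nat) (N d : nat) :
  \big[minn/N]_(i | P i) F i <= d -> d < N -> exists2 i, P i & F i <= d.
Proof.
move=> le_d lt_dN; apply/exists_inP; apply: contraTT le_d => /exists_inPn FP.
rewrite -ltnNge; elim/big_ind: _ => // [x y dx dy|i Pi].
  by rewrite leq_min dx.
by rewrite ltnNge FP.
Qed.

Lemma sd_le_card (T : finType) (e : rel T) V u v : sd e V u v <= #|T|.
Proof. exact: max_card. Qed.

Lemma bigminn_le_idx (I : Type) (s : seq I) (P : pred I) (F : I -> nat) (N : nat) :
  \big[minn/N]_(i <- s | P i) F i <= N.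
Proof.
elim: s => [|i s IHs]; rewrite ?big_nil ?big_cons //.
by case: ifP => // _; rewrite geq_min IHs orbT.
Qed.

Lemma sdd_fuel_le_card (T : finType) (e : rel T) k V : sdd_fuel e k V <= #|T|.
Proof. by case: k => //= k; case: ifP => // _; exact: bigminn_le_idx. Qed.

Lemma sdd_fuel_twins (T : finType) (e : rel T) k (V : {set T}) d :
  1 < #|V| -> sdd_fuel e k.+1 V <= d ->
  exists u v, [/\ u \in V, v \in V, v != u, sd e V u v <= d
                & sdd_fuel e k (V :\ v) <= d].
Proof.
move=> V_gt1 /=; rewrite ifN -?ltnNge // => le_d.
(* If [#|T| <= d], the default of the minimum meets the bound and no pair can be read off; but then
   any two distinct vertices serve, since no value exceeds [#|T|]. *)
have [le_Td|lt_dT] := leqP #|T| d.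
  have [u [v [uV vV neq_uv]]] : exists u v, [/\ u \in V, v \in V & u != v].
    by move/card_gt1P: V_gt1.
  exists u, v; split=> //; first by rewrite eq_sym.
    exact: leq_trans (sd_le_card _ _ _ _) _.
  exact: leq_trans (sdd_fuel_le_card _ _ _) _.
have [u uV] := bigminn_attained le_d lt_dT.
case/bigminn_attained=> // v /andP[vV neq_vu]; rewrite geq_max => /andP[le1 le2].
by exists u, v.
Qed.

(** * Adjacency by prioritised rectangles *)

(* [((a, b), (c, d), g)] is the rectangle [a, b) x [c, d) with priority [g]; the
   parity of [g] is the adjacency bit. *)
Definition rect := (nat * nat * (nat * nat) * nat)%type.

Definition inside (I : nat * nat) (p : nat) := (I.1 <= p) && (p < I.2).
Definition hit (r : rect) (p q : nat) := inside r.1.1 p && inside r.1.2 q.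
Definition topcode (R : seq rect) (p q : nat) := \max_(r <- R | hit r p q) r.2.

Lemma le_topcode R p q r : r \in R -> hit r p q -> r.2 <= topcode R p q.
Proof. exact: (@leq_bigmax_seq _ R (fun r => hit r p q) (fun r => r.2)). Qed.

Definition unit_itv (p : nat) : nat * nat := (p, p.+1).

Lemma inside_unit p q : inside (unit_itv p) q = (p == q).
Proof. by rewrite /inside /= ltnS eqn_leq. Qed.

(* Positions after a new item is inserted just behind position [p]; interval
   endpoints move the same way, so an interval containing [p] absorbs the new item. *)
Definition shift (p a : nat) := if p < a then a.+1 else a.
Definition shift_rect (p : nat) (r : rect) : rect :=
  ((shift p r.1.1.1, shift p r.1.1.2), (shift p r.1.2.1, shift p r.1.2.2), r.2).

Lemma leq_shift p : {mono shift p : a b / a <= b}.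
Proof. by move=> a b; rewrite /shift; case: (ltnP p a); case: (ltnP p b); lia. Qed.

Lemma shift_le p a k : a <= k -> shift p a <= k.+1.
Proof. by rewrite /shift; case: ifP; lia. Qed.

Lemma inside_shift p I q :
  inside (shift p I.1, shift p I.2) (shift p q) = inside I q.
Proof. by rewrite /inside /= (leqW_mono (@leq_shift p)) leq_shift. Qed.

Lemma inside_shift_new p I :
  inside (shift p I.1, shift p I.2) p.+1 = inside I p.
Proof.
rewrite /inside /shift /=; case: I => a b /=.
by case: (ltnP p a); case: (ltnP p b); lia.
Qed.

(** Vertex number [k] uses only the priorities [k.*2] and [k.*2.+1], one per adjacency bit; hence
    the last bound. *)
Definition rect_bounded (k : nat) (r : rect) :=
  [&& r.1.1.1 <= k, r.1.1.2 <= k, r.1.2.1 <= k, r.1.2.2 <= k & r.2 < k.*2.+2].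

(** By induction on [k]: reinserting a vertex adds at most [d.+1] cells in its row and as many in
    its column. *)
Lemma sdd_rectangles (T : finType) (e : rel T) (d k : nat) (V : {set T}) :
  symmetric e -> #|V| = k -> sdd_fuel e k V <= d ->
  exists pos : T -> nat, exists R : seq rect,
  [/\ size R <= d.+1.*2 * k, all (rect_bounded k) R,
      {in V, forall x, pos x < k}, {in V &, injective pos}
    & {in V &, forall x y, x != y -> odd (topcode R (pos x) (pos y)) = e x y}].
Proof.
move=> sym_e; elim: k V => [|k IHk] V cardV le_d.
  by exists (fun=> 0), [::]; move/eqP: cardV; rewrite cards_eq0 => /eqP->;
    split=> // x; rewrite inE.
have [V_le1|V_gt1] := leqP #|V| 1.
  exists (fun=> 0), [::]; split=> //.
    by move=> x y xV yV _; apply: (card_le1_eqP V_le1).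
  by move=> x y xV yV; rewrite (card_le1_eqP V_le1 x y) ?eqxx.
have [u [v [uV vV neq_vu sd_uv sdd_Vv]]] := sdd_fuel_twins V_gt1 le_d.
have cardVv: #|V :\ v| = k by move: cardV; rewrite (cardsD1 v) vV => -[].
have [pos [R [szR bndR posk inj_pos adj]]] := IHk _ cardVv sdd_Vv.
pose pu := pos u.
pose pos' x := if x == v then pu.+1 else shift pu (pos x).
pose old x := if x == v then u else x.
(* [u] is included because the entry copied for the pair of [u] and [v] would be the diagonal one at
   [u], which the induction hypothesis leaves open. *)
pose X := u |: [set w in V | [&& w != u, w != v & e u w != e v w]].
pose cell w := (unit_itv (pos' v), unit_itv (pos' w), k.+1.*2 + e v w).
pose Rrow := [seq cell w | w <- enum X].
pose Rcol := [seq ((cell w).1.2, (cell w).1.1, (cell w).2) | w <- enum X].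
pose R' := [seq shift_rect pu r | r <- R].
have uVv: u \in V :\ v by rewrite !inE eq_sym neq_vu.
have pu_lt: pu < k by exact: posk.
have oldV x : x \in V -> old x \in V :\ v.
  by move=> xV; rewrite /old; case: (eqVneq x v) => // xv; rewrite !inE xv.
have pos'k : {in V, forall x, pos' x < k.+1}.
  move=> x xV; rewrite /pos'; case: eqVneq => [_|xv]; first by rewrite ltnS.
  have := posk x; rewrite !inE xv xV => /(_ isT); by rewrite /shift; case: ifP; lia.
have inj_pos' : {in V &, injective pos'}.
  have inj_v x : x \in V -> x != v -> pos' x != pu.+1.
    move=> xV xv; rewrite /pos' (negPf xv) /shift; case: ifP; lia.
  move=> x y xV yV; have [->|xv] := eqVneq x v.
    have [->//|yv] := eqVneq y v.
    by move/eqP; rewrite {1}/pos' eqxx eq_sym (negPf (inj_v y yV yv)).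
  have [->|yv] := eqVneq y v.
    by move/eqP; rewrite {2}/pos' eqxx (negPf (inj_v x xV xv)).
  rewrite /pos' (negPf xv) (negPf yv) => eq_xy.
  apply: inj_pos; rewrite ?inE ?xv ?yv //.
  exact: (incn_inj (@leq_shift pu)) eq_xy.
have XV : {subset X <= V}.
  by move=> x; rewrite !inE => /orP[/eqP->//|/andP[]].
have hit' r x y :
    hit (shift_rect pu r) (pos' x) (pos' y) = hit r (pos (old x)) (pos (old y)).
  have in' I z :
      inside (shift pu I.1, shift pu I.2) (pos' z) = inside I (pos (old z)).
    by rewrite /pos' /old; case: ifP => _; rewrite ?inside_shift ?inside_shift_new.
  by rewrite /hit /= !in'.
have oldcode x y :
    topcode R' (pos' x) (pos' y) = topcode R (pos (old x)) (pos (old y)).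
  by rewrite /topcode big_map; apply: eq_bigl => r; rewrite hit'.
have oldcode_lt p q : topcode R p q < k.+1.*2.
  rewrite ltnS; apply/bigmax_leqP_seq => r rR _.
  by move/allP: bndR => /(_ r rR) /and5P[_ _ _ _].
have v_notX : v \notin X by rewrite !inE (negPf neq_vu) eqxx !andbF.
have rowE x y : x \in V -> y \in V ->
    topcode Rrow (pos' x) (pos' y) =
      if (x == v) && (y \in X) then k.+1.*2 + e v y else 0.
  move=> xV yV; rewrite /topcode big_map -big_filter.
  have -> : [seq w <- enum X | hit (cell w) (pos' x) (pos' y)] =
      if (x == v) && (y \in X) then [:: y] else [::].
    have hitE w : w \in enum X ->
        hit (cell w) (pos' x) (pos' y) = (x == v) && (w == y).
      rewrite mem_enum => /XV wV.
      by rewrite /hit !inside_unit !(inj_in_eq inj_pos') // (eq_sym v).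
    rewrite (eq_in_filter hitE); case: (x == v) => /=; last exact: filter_pred0.
    case: ifP => yX; first by rewrite filter_pred1_uniq ?enum_uniq // mem_enum.
    apply/eqP; rewrite -size_eq0 size_filter count_uniq_mem ?enum_uniq //.
    by rewrite mem_enum yX.
  by case: ifP => _; rewrite ?big_seq1 ?big_nil.
have colE x y : topcode Rcol (pos' x) (pos' y) = topcode Rrow (pos' y) (pos' x).
  by rewrite /topcode !big_map; apply: eq_bigl => w; rewrite /hit /= andbC.
exists pos', (Rrow ++ Rcol ++ R'); split=> //.
- rewrite !size_cat !size_map -!cardE mulnS.
  have : #|X| <= d.+1.
    rewrite cardsU1; apply: (leq_trans (leq_add (leq_b1 _) sd_uv)); lia.
  move: szR; lia.
- have bndN x y w : x \in V -> y \in V ->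
      rect_bounded k.+1 (unit_itv (pos' x), unit_itv (pos' y), k.+1.*2 + e v w).
    move=> /pos'k xk /pos'k yk; rewrite /rect_bounded /=; case: (e v w); lia.
  rewrite !all_cat; apply/and3P; split; apply/allP => r /mapP[].
  + by move=> w; rewrite mem_enum => /XV wV ->; apply: bndN.
  + by move=> w; rewrite mem_enum => /XV wV ->; apply: bndN.
  + move=> s /(allP bndR) bs ->; move: bs; rewrite /rect_bounded /=.
    by case/and5P=> b1 b2 b3 b4 b5; rewrite !shift_le //= doubleS ltnW // ltnW.
move=> x y xV yV neq_xy.
have topE : topcode (Rrow ++ Rcol ++ R') (pos' x) (pos' y) =
    maxn (if (x == v) && (y \in X) then k.+1.*2 + e v y else 0)
      (maxn (if (y == v) && (x \in X) then k.+1.*2 + e v x else 0)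
        (topcode R (pos (old x)) (pos (old y)))).
  by rewrite /topcode !big_cat /= -!/(topcode _ _ _) colE !rowE // oldcode.
(* New priorities exceed all old ones, and their parity is the added bit. *)
have newcode (b : bool) p q : odd (maxn (k.+1.*2 + b) (topcode R p q)) = b.
  rewrite (maxn_idPl _) ?oddD ?odd_double ?oddb //.
  exact: leq_trans (ltnW (oldcode_lt p q)) (leq_addr _ _).
have twin z : z \in V -> z != v -> z \notin X -> (u != z) /\ e u z = e v z.
  move=> zV zv; rewrite !inE zV zv /= negb_or => /andP[zu].
  move/negP=> same; split; first by rewrite eq_sym.
  by apply/eqP/negPn/negP => neq_e; apply: same; apply/andP.
rewrite {}topE; have [eq_xv|xv] := eqVneq x v; have [eq_yv|yv] := eqVneq y v => /=.
- by rewrite eq_xv eq_yv eqxx in neq_xy.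
- rewrite max0n eq_xv; case: ifP => [_|/negbT yX]; first exact: newcode.
  have [uy <-] := twin y yV yv yX.
  by rewrite max0n /old eqxx (negPf yv) adj // !inE yv.
- rewrite max0n eq_yv (sym_e x v); case: ifP => [_|/negbT xX]; first exact: newcode.
  have [ux <-] := twin x xV xv xX.
  by rewrite max0n /old eqxx (negPf xv) adj ?(sym_e u) // ?inE ?xv // eq_sym.
- by rewrite !max0n /old (negPf xv) (negPf yv) adj // !inE ?xv ?yv.
Qed.

(** * Blocks of positions and the rectangles splitting them *)

Definition ends_below (r : rect) (p : nat) : nat :=
  (r.1.1.1 <= p) + (r.1.1.2 <= p) + (r.1.2.1 <= p) + (r.1.2.2 <= p).

Lemma ends_below_le4 r p : ends_below r p <= 4.
Proof. by rewrite -[4]/(1 + 1 + 1 + 1) !leq_add ?leq_b1. Qed.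

Lemma leq_ends_below r p p' : p <= p' -> ends_below r p <= ends_below r p'.
Proof.
have mono a : p <= p' -> (a <= p : nat) <= (a <= p').
  by move=> le_pp'; case: (leqP a p) => // /leq_trans ->.
by move=> le_pp'; rewrite /ends_below !leq_add ?mono.
Qed.

(** [ends_below] sums four indicators, each monotone in the position, so equal sums force equal
    indicators. *)
Lemma hit_ends_below r p p' q q' :
  ends_below r p = ends_below r p' -> ends_below r q = ends_below r q' ->
  hit r p q = hit r p' q'.
Proof.
have const s t : s <= t -> ends_below r s = ends_below r t ->
    inside r.1.1 s = inside r.1.1 t /\ inside r.1.2 s = inside r.1.2 t.
  case: r => [[[a b] [c d]] g] /= le_st; rewrite /ends_below /inside /= !ltnNge.
  have mono x : (x <= s : nat) <= (x <= t).
    by case: (leqP x s) => // /leq_trans ->.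
  move: (mono a) (mono b) (mono c) (mono d).
  by case: (a <= s); case: (a <= t); case: (b <= s); case: (b <= t);
     case: (c <= s); case: (c <= t); case: (d <= s); case: (d <= t).
have const' s t : ends_below r s = ends_below r t ->
    inside r.1.1 s = inside r.1.1 t /\ inside r.1.2 s = inside r.1.2 t.
  move=> eq_st.
  by case/orP: (leq_total s t) => [/const/(_ eq_st)|/const/(_ (esym eq_st))[-> ->]].
by move=> /const'[eq_p _] /const'[_ eq_q]; rewrite /hit eq_p eq_q.
Qed.

Section Blocks.

Variables (n K : nat) (R : seq rect).

Definition total_below (p : nat) : nat := \sum_(r <- R) ends_below r p.

(* Blocks are intervals of positions, cut so that fewer than [K] rectangle ends fall
   strictly inside each of them. *)
Definition block (p : nat) : nat := total_below p %/ K.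

Definition nblocks : nat := (total_below n %/ K).+1.

Definition local (j : nat) (r : rect) : bool :=
  [exists p : 'I_n, exists p' : 'I_n,
    [&& block p == j, block p' == j & ends_below r p != ends_below r p']].

Definition locals (j : nat) : seq rect := [seq r <- R | local j r].

Definition global_code (i j : nat) : nat :=
  \max_(r <- R | [&& ~~ local i r, ~~ local j r &
    [exists p : 'I_n, exists q : 'I_n,
      [&& block p == i, block q == j & hit r p q]]]) r.2.

Lemma leq_total_below p p' : p <= p' -> total_below p <= total_below p'.
Proof. by move=> le_pp'; apply: leq_sum => r _; apply: leq_ends_below. Qed.

Lemma total_below_le p : total_below p <= 4 * size R.
Proof.
rewrite -sum1_size big_distrr; apply: leq_sum => r _.
exact: ends_below_le4.
Qed.

(** From the first to the last position of a block [total_below] grows by less than [K], and each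
    local rectangle contributes at least one to that growth. *)
Lemma size_locals j : 0 < K -> size (locals j) < K.
Proof.
move=> K_gt0; have [p /eqP bp|no_p] := pickP (fun p : 'I_n => block p == j); last first.
  rewrite (_ : locals j = [::]) //; apply/eqP; rewrite -[_ == _]negbK -has_filter.
  by apply/hasPn => r _; apply/existsPn => p; apply/existsPn => p'; rewrite no_p.
have Pp : block p == j by apply/eqP.
case: (@arg_minnP _ p (fun q : 'I_n => block q == j) (fun q : 'I_n => val q) Pp).
move=> p0 /eqP b0 min0.
case: (@arg_maxnP _ p (fun q : 'I_n => block q == j) (fun q : 'I_n => val q) Pp).
move=> p1 /eqP b1 max1.
have le01 : p0 <= p1 by apply: min0; rewrite b1.
have gap : size (locals j) + total_below p0 <= total_below p1.
  rewrite /locals size_filter -sum1_count big_mkcond -big_split /=.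
  apply: leq_sum => r _; case: ifP => [|_]; last exact: leq_ends_below.
  rewrite add1n ltn_neqAle leq_ends_below // andbT.
  case/existsP=> q /existsP[q' /and3P[bq bq']].
  apply: contraNneq => eq01.
  have mid (s : 'I_n) : block s == j -> ends_below r s = ends_below r p0.
    move=> bs; apply/eqP; rewrite eqn_leq andbC leq_ends_below ?min0 //.
    by rewrite eq01 leq_ends_below //; apply: max1.
  by rewrite (mid q) // (mid q').
move: b0 b1 gap; rewrite /block => b0 b1.
rewrite (divn_eq (total_below p0) K) (divn_eq (total_below p1) K) b0 b1.
have := ltn_pmod (total_below p1) K_gt0; lia.
Qed.

Lemma block_lt p : p < n -> block p < nblocks.
Proof. by move=> lt_pn; rewrite ltnS leq_div2r // leq_total_below // ltnW. Qed.

(** A rectangle behind the global code contains some point of the product of the blocks, hence every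
    point, as its end counts are constant on both. *)
Lemma topcode_block (p q : 'I_n) :
  topcode R p q = maxn (global_code (block p) (block q))
    (maxn (topcode (locals (block p)) p q) (topcode (locals (block q)) p q)).
Proof.
have nonlocal r (s s' : 'I_n) : ~~ local (block s) r -> block s' == block s ->
    ends_below r s = ends_below r s'.
  move=> + b_ss'; apply: contraNeq => neq; apply/existsP; exists s.
  by apply/existsP; exists s'; rewrite eqxx b_ss'.
apply/eqP; rewrite eqn_leq !geq_max; apply/andP; split.
  apply/bigmax_leqP_seq => r rR hr; rewrite !leq_max.
  have [lp|nlp] := boolP (local (block p) r).
    have r_loc : r \in locals (block p) by rewrite mem_filter lp.
    by rewrite (le_topcode r_loc) ?orbT.
  have [lq|nlq] := boolP (local (block q) r).
    have r_loc : r \in locals (block q) by rewrite mem_filter lq.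
    by rewrite (le_topcode r_loc) ?orbT.
  rewrite /global_code (@leq_bigmax_seq _ R _ (fun r => r.2)) // nlp nlq /=.
  by apply/existsP; exists p; apply/existsP; exists q; rewrite !eqxx.
apply/and3P; split; apply/bigmax_leqP_seq => r.
- move=> rR /and3P[nlp nlq /existsP[p' /existsP[q' /and3P[bp bq hr]]]].
  have eq_p := nonlocal _ _ _ nlp bp; have eq_q := nonlocal _ _ _ nlq bq.
  by rewrite le_topcode // (hit_ends_below eq_p eq_q).
- rewrite mem_filter => /andP[_ rR] hr; exact: le_topcode.
- rewrite mem_filter => /andP[_ rR] hr; exact: le_topcode.
Qed.

(** * Labels as words of numbers *)

Definition rect_entries (r : rect) : seq nat :=
  [:: r.1.1.1; r.1.1.2; r.1.2.1; r.1.2.2; r.2].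

(** The third number tells the decoder where the global codes stop and the rectangles start. *)
Definition word (p : nat) : seq nat :=
  [:: p; block p; nblocks] ++ [seq global_code (block p) j | j <- iota 0 nblocks]
    ++ flatten [seq rect_entries r | r <- locals (block p)].

Lemma size_word p : 0 < K -> size (word p) <= 3 + nblocks + 5 * K.
Proof.
move=> K_gt0; rewrite /word !size_cat size_map size_iota -addnA !leq_add2l.
have -> : size (flatten [seq rect_entries r | r <- locals (block p)]) =
    5 * size (locals (block p)).
  by elim: (locals _) => //= r s ->; rewrite mulnS.
by rewrite leq_mul2l ltnW // size_locals.
Qed.

Lemma word_bounded N p : all (rect_bounded n) R -> n.*2.+2 <= N -> nblocks < N ->
  p < n -> all (fun x => x < N) (word p).
Proof.
move=> bndR le_nN lt_bN lt_pn; rewrite /word 2!all_cat; apply/andP; split.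
  rewrite /= lt_bN (leq_trans (block_lt lt_pn) (ltnW lt_bN)) !andbT; lia.
 apply/andP; split; apply/allP => x.
  case/mapP=> j _ ->; apply: leq_trans le_nN; rewrite ltnS.
  apply/bigmax_leqP_seq => r rR _.
  by have /and5P[_ _ _ _] := allP bndR r rR.
case/flattenP=> s /mapP[r]; rewrite mem_filter => /andP[_ /(allP bndR)].
by rewrite /rect_bounded => bnd -> ; rewrite !inE; lia.
Qed.

End Blocks.

Fixpoint parse_rects (s : seq nat) : seq rect :=
  if s is [:: a, b, c, d, g & s'] then ((a, b), (c, d), g) :: parse_rects s' else [::].

Lemma parse_rectsK R : parse_rects (flatten [seq rect_entries r | r <- R]) = R.
Proof. by elim: R => //= -[[[a b] [c d]] g] R ->. Qed.

(** Global codes are read from [s] only, at the block number stored in [t]. *)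
Definition decide (s t : seq nat) : bool :=
  let p := nth 0 s 0 in let q := nth 0 t 0 in
  let rects s := parse_rects (drop (3 + nth 0 s 2) s) in
  odd (maxn (nth 0 (drop 3 s) (nth 0 t 1))
    (maxn (topcode (rects s) p q) (topcode (rects t) p q))).

Lemma decide_word n K R (p q : 'I_n) :
  decide (word n K R p) (word n K R q) = odd (topcode R p q).
Proof.
have rectsE p' : parse_rects (drop (3 + nth 0 (word n K R p') 2) (word n K R p'))
    = locals n K R (block K R p').
  by rewrite /word catA drop_size_cat ?size_cat ?size_map ?size_iota // parse_rectsK.
rewrite (topcode_block K) /decide !rectsE; congr (odd (maxn _ _)).
have lt_b := block_lt K R (ltn_ord q).
rewrite {1}/word drop_size_cat // nth_cat size_map size_iota lt_b.
by rewrite (nth_map 0) ?size_iota // nth_iota.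
Qed.

(** * Self-delimiting binary encoding *)

(* Each bit is preceded by [true] and each number is closed by [false]. *)
Fixpoint nat_bits (w k : nat) : seq bool :=
  if w is w'.+1 then [:: true, odd k & nat_bits w' k./2] else [:: false].

Fixpoint parse_bits (weight acc : nat) (s : seq bool) : seq nat :=
  match s with
  | [:: true, b & s'] => parse_bits weight.*2 (acc + weight * b) s'
  | false :: s' => acc :: parse_bits 1 0 s'
  | _ => [::]
  end.

(** Bits come least significant first; each one doubles [weight] and feeds [acc], so the induction
    needs both arbitrary. *)
Lemma nat_bitsK w weight acc k s : k < 2 ^ w ->
  parse_bits weight acc (nat_bits w k ++ s) = acc + weight * k :: parse_bits 1 0 s.
Proof.
elim: w weight acc k => [|w IHw] weight acc k.
  by rewrite expn0 ltnS leqn0 => /eqP->; rewrite /= muln0 addn0.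
rewrite expnS => lt_k /=; rewrite IHw; last first.
  by have := odd_double_half k; lia.
congr (_ :: _); rewrite -{3}(odd_double_half k) mulnDr addnA -!muln2; lia.
Qed.

Lemma size_nat_bits w k : size (nat_bits w k) = w.*2.+1.
Proof. by elim: w k => //= w IHw k; rewrite IHw. Qed.

Definition word_bits (w : nat) (s : seq nat) := flatten [seq nat_bits w k | k <- s].

Lemma word_bitsK w s : all (fun k => k < 2 ^ w) s -> parse_bits 1 0 (word_bits w s) = s.
Proof.
elim: s => //= k s IHs /andP[lt_k /IHs]; rewrite /word_bits /= nat_bitsK // => ->.
by rewrite mul1n.
Qed.

Lemma size_word_bits w s : size (word_bits w s) = size s * w.*2.+1.
Proof. by elim: s => //= k s IHs; rewrite size_cat size_nat_bits IHs mulSn. Qed.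

(** * Label lengths *)

Lemma sqrtn_floor m : exists2 K, K ^ 2 <= m & m < K.+1 ^ 2.
Proof.
have ex : exists K, K ^ 2 <= m by exists 0.
have bnd K : K ^ 2 <= m -> K <= m.
  by apply: leq_trans; rewrite -mulnn; case: K => // K; rewrite leq_pmulr.
case: (ex_maxnP ex bnd) => K le_K max_K; exists K => //.
by rewrite ltnNge; apply/negP => /max_K; rewrite ltnn.
Qed.

Lemma trunc_log_le_log2 n : (0 < n)%N -> (INR (trunc_log 2 n) <= log2 (INR n))%R.
Proof.
move=> n_gt0; have ln2 : (0 < ln 2)%R by have := ln_lt_2; lra.
have le_n : (2 ^ trunc_log 2 n <= INR n)%R.
  have <- : INR (2 ^ trunc_log 2 n) = (2 ^ trunc_log 2 n)%R.
    by elim: (trunc_log 2 n) => // k IHk; rewrite expnS -multE mult_INR IHk.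
  by apply/le_INR/leP; rewrite trunc_logP.
rewrite /log2; apply: (Rmult_le_reg_r (ln 2)) => //.
rewrite /Rdiv Rmult_assoc Rinv_l ?Rmult_1_r; last lra.
rewrite -ln_pow; last lra.
have pos : (0 < 2 ^ trunc_log 2 n)%R by apply: pow_lt; lra.
by case: le_n => [lt|->]; [left; apply: ln_increasing|right].
Qed.

Lemma sdd_labels d n (e : rel 'I_n) :
  (0 < d)%N -> (2 <= n)%N -> symmetric e -> (sdd_graph e <= d)%N ->
  exists K, [/\ K ^ 2 <= d * n & exists l : 'I_n -> seq bool,
    (forall v, size (l v) <= 1387 * (K * trunc_log 2 n)) /\
    (forall u v, u != v ->
       decide (parse_bits 1 0 (l u)) (parse_bits 1 0 (l v)) = e u v)].
Proof.
move=> d_gt0 n_ge2 sym_e sdd_d.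
(* Labels are built for min(d, n), so that block numbers are O(n). *)
pose m := minn d n.
have m_gt0 : 0 < m by rewrite /m; lia.
have sdd_m : sdd_graph e <= m.
  by rewrite leq_min sdd_d -[X in _ <= X]card_ord sdd_fuel_le_card.
have [pos [R [szR bndR pos_lt _ adj]]] := sdd_rectangles sym_e (erefl _) sdd_m.
rewrite cardsT card_ord in szR bndR pos_lt.
have [K le_K lt_K] := sqrtn_floor (m * n).
have K_gt0 : 0 < K by case: (K) lt_K => //; have := muln_gt0 m n; lia.
have le_Kn : K <= n.
  rewrite -leq_sqr; apply: leq_trans le_K _; rewrite -mulnn leq_mul2r geq_minr; lia.
exists K; split; first by apply: leq_trans le_K _; rewrite leq_mul2r geq_minl orbT.
(* [total_below] is at most [4 * size R <= 16 * (m * n)], and [m * n < K.+1 ^ 2 <= 4 * K ^ 2];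
   dividing by [K] gives [64 * K]. *)
have le_b : nblocks n K R <= 64 * K + 1.
  rewrite /nblocks addn1 ltnS -[X in _ <= X](mulnK _ K_gt0) leq_div2r //.
  apply: leq_trans (total_below_le _ _) _; rewrite -mulnn in le_K lt_K.
  have : m.+1.*2 * n <= 4 * (m * n) by nia.
  nia.
have p_lt v : pos v < n by apply: pos_lt; rewrite inE.
pose p v := Ordinal (p_lt v); set t := trunc_log 2 n.
have [t_le t_lt] : 2 ^ t <= n /\ n < 2 ^ t.+1.
  by apply/andP; apply: trunc_log_bounds => //; lia.
have t_gt0 : 0 < t by case: (t) t_lt => //; lia.
(* All numbers are below [128 * n], and [n < 2 ^ t.+1]; hence the width [t + 8]. *)
have bnd v : all (fun k => k < 2 ^ (t + 8)) (word n K R (p v)).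
  have lt_N : 128 * n < 2 ^ (t + 8) by move: t_lt; rewrite expnD expnS; lia.
  by apply: word_bounded => //; lia.
exists (fun v => word_bits (t + 8) (word n K R (p v))); split=> [v|u v neq_uv].
  rewrite size_word_bits; have := size_word n R (p v) K_gt0 => le_s.
  (* [3 + (64 * K + 1) + 5 * K <= 73 * K] numbers, each of [2 * (t + 8) + 1 <= 19 * t] bits, and
     [73 * 19 = 1387]. *)
  have le_s' : size (word n K R (p v)) <= 73 * K by lia.
  apply: leq_trans (leq_mul le_s' (leqnn _)) _; nia.
by rewrite !word_bitsK // decide_word adj ?inE.
Qed.

Theorem theorem1p2 :
  exists C : R, (0 < C)%R /\
  forall d : nat, (1 <= d)%N ->
  exists D : seq bool -> seq bool -> bool,
  forall (n : nat) (e : rel 'I_n),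
    (2 <= n)%N -> symmetric e -> irreflexive e ->
    (sdd_graph e <= d)%N ->
    exists l : 'I_n -> seq bool,
      (forall v : 'I_n,
         (INR (size (l v)) <= C * sqrt (INR d * INR n) * (log2 (INR n)) ^ 3)%R) /\
      (forall u v : 'I_n, u != v -> D (l u) (l v) = e u v).
Proof.
exists 1387%R; split=> [|d d_gt0]; first lra.
(* One decoder serves all [d] and [n]: labels carry [nblocks], and the bit code delimits itself. *)
exists (fun s t => decide (parse_bits 1 0 s) (parse_bits 1 0 t)).
move=> n e n_ge2 sym_e _ sdd_d.
have [K [le_K [l [sz_l adj]]]] := sdd_labels d_gt0 n_ge2 sym_e sdd_d.
exists l; split=> // v.
have n_gt0 : 0 < n by exact: ltnW.
set t := trunc_log 2 n in sz_l.
have t_ge1 : (1 <= INR t)%R.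
  by rewrite (_ : 1%R = INR 1) //; apply/le_INR/leP; rewrite trunc_log_gt0.
have t_le : (INR t <= log2 (INR n))%R by exact: trunc_log_le_log2.
have K_le : (INR K <= sqrt (INR d * INR n))%R.
  rewrite -(sqrt_square (INR K)); last exact: pos_INR.
  by apply: sqrt_le_1_alt; rewrite -!mult_INR !multE mulnn; apply/le_INR/leP.
have sz : (INR (size (l v)) <= 1387 * (INR K * INR t))%R.
  have -> : (1387 = INR 1387)%R by rewrite INR_IZR_INZ.
  by rewrite -!mult_INR !multE; apply/le_INR/leP.
(* The cube is no smaller than the logarithm, which is at least 1. *)
have log_le : (INR t <= log2 (INR n) ^ 3)%R by nra.
apply: (Rle_trans _ _ _ sz); rewrite Rmult_assoc; apply: Rmult_le_compat_l; first lra.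
by apply: Rmult_le_compat => //; exact: pos_INR.
Qed.
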